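(* For every integer $n\ge 1$, \[ \mathsf{HDE}(P_4,P_{4n+2}) = \frac{4n+1}{4n^2+3n+1}. \]
   Context: Graphs are finite directed graphs; homomorphisms $\varphi:F\to G$ are maps $V_F\to V_G$ sending edges to edges; $\hom(F,G)$ is their number. For $F\to G$ (i.e. $\hom(F,G)\ge1$), $\mathsf{HDE}(F,G)=\sup\{c\in\mathbb R:\hom(F,T)\ge\hom(G,T)^c\text{ for all graphs }T\}$. $P_m$ is the undirected path with $m$ vertices and $m-1$ edges, viewed as a directed graph with each undirected edge present in both directions. *)

(* Defs.v *)
From mathcomp Require Import all_boot.
From Stdlib Require Import Reals.

Set Implicit Arguments.
Unset Strict Implicit.
Unset Printing Implicit Defensive.

Record graph := Graph { vert : finType; edge : rel vert }.

Definition is_hom (F G : graph) (f : {ffun vert F -> vert G}) : bool :=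
  [forall x : vert F, forall y : vert F, edge x y ==> edge (f x) (f y)].

Definition hom (F G : graph) : nat := #|[set f | @is_hom F G f]|.

(* Real power x^c with x >= 0; convention 0^c := 0 (only relevant when
   hom(G,T) = 0, where hom(F,T) >= 0 holds anyway for the relevant c > 0). *)
Definition rpow (x c : R) : R :=
  if Rlt_dec 0 x then Rpower x c else 0%R.

Definition HDE_set (F G : graph) (c : R) : Prop :=
  forall T : graph, (rpow (INR (@hom G T)) c <= INR (@hom F T))%R.

Definition HDE_eq (F G : graph) (r : R) : Prop := is_lub (@HDE_set F G) r.

Definition path_graph (m : nat) : graph :=
  @Graph 'I_m (fun i j : 'I_m => (i.+1 == j :> nat) || (j.+1 == i :> nat)).

(* Main.v *)
(* Homomorphisms from [P_(m+1)] to [T] are the walks of length [m] in the graph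
   of bidirected edges of [T].  Put [m = 4n + 1] and let [x_0 ... x_m] be a
   uniformly random walk, with [h_i] the entropy of [x_i] and [e_i] that of
   [(x_i, x_(i+1))]; the number [W] of walks satisfies
   [ln W = sum e_i - sum_(0 < i < m) h_i].  By Gibbs' inequality [ln w_3], with
   [w_3] the number of walks of length 3, is at least the entropy of each
   Markov walk of length 3 built from these edge distributions.  A nonnegative
   combination of these inequalities, of [e_i <= h_i + h_(i+1)], of
   [h_0 <= e_0] and of [h_m <= e_(m-1)] (the dual solution of a linear program)
   yields [(4n+1) ln W <= (4n^2+3n+1) ln w_3].
   The primal solution is attained up to constant factors by layered graphs
   with [4n + 2] layers whose sizes are powers of [q]; for these
   [w_3 = O(q^(4n+1))] and [W >= q^(4n^2+3n+1)], and [q] goes to infinity. *)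

Require Import Defs.
From HB Require Import structures.
From mathcomp Require Import all_boot.
From mathcomp Require Import zify.
From Stdlib Require Import Reals Lra.
From mathcomp Require Import ssrnat.

Set Implicit Arguments.
Unset Strict Implicit.
Unset Printing Implicit Defensive.

(** * Homomorphisms from paths as walks *)

(* Both arcs are required because [path_graph] has both orientations of each
   of its edges. *)
Definition adj (G : graph) : rel (vert G) := fun x y => edge x y && edge y x.

Lemma adj_sym (G : graph) : symmetric (@adj G).
Proof. by move=> x y; rewrite /adj andbC. Qed.

Fixpoint walks (T : finType) (E : rel T) (k : nat) (u : T) : nat :=
  if k is k'.+1 then \sum_(v | E u v) walks E k' v else 1.

Lemma walksS (T : finType) (E : rel T) k u :
  walks E k.+1 u = \sum_(v | E u v) walks E k v.
Proof. by []. Qed.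

Lemma big_tuple_cons (T : finType) k (F : k.+1.-tuple T -> nat) :
  \sum_(t : k.+1.-tuple T) F t =
  \sum_(x : T) \sum_(t : k.-tuple T) F [tuple of x :: t].
Proof.
rewrite pair_big /=.
rewrite (reindex (fun p : T * k.-tuple T => [tuple of p.1 :: p.2])) //=.
exists (fun t : k.+1.-tuple T => (thead t, [tuple of behead t])).
  by case=> x t _; congr pair; apply: val_inj.
by move=> t _; rewrite /= -tuple_eta.
Qed.

Lemma sum_path_tuple (T : finType) (E : rel T) k u :
  \sum_(t : k.-tuple T) (path E u t : nat) = walks E k u.
Proof.
elim: k u => [|k IHk] u.
  rewrite (eq_bigr (fun=> 1)) => [|t _]; last by rewrite tuple0.
  by rewrite sum1_card card_tuple expn0.
rewrite big_tuple_cons [RHS]big_mkcond; apply: eq_bigr => x _ /=.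
case: (E u x) => /=; first exact: IHk.
by rewrite big1.
Qed.

Lemma is_hom_pathE (G : graph) m (f : {ffun 'I_m.+1 -> vert G}) :
  @is_hom (path_graph m.+1) G f =
  sorted (@adj G) [tuple f i | i < m.+1].
Proof.
have nthE i (lt_i : i < m.+1) :
    nth (f ord0) [tuple f i | i < m.+1] i = f (Ordinal lt_i).
  by rewrite -[LHS](tnth_nth _ _ (Ordinal lt_i)) tnth_mktuple.
apply/'forall_forallP/(sortedP (f ord0)).
  move=> hom_f i; rewrite size_tuple => lt_i.
  rewrite (nthE _ lt_i) (nthE _ (ltnW lt_i)) /adj.
  have /implyP -> := hom_f (Ordinal (ltnW lt_i)) (Ordinal lt_i);
    last by rewrite /= eqxx.
  by have /implyP -> := hom_f (Ordinal lt_i) (Ordinal (ltnW lt_i));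
    last by rewrite /= eqxx orbT.
move=> sorted_f [i lt_i] [j lt_j]; apply/implyP => /= /orP[] /eqP eq_ij.
  have := sorted_f i; rewrite size_tuple eq_ij => /(_ lt_j).
  by rewrite (nthE _ lt_i) (nthE _ lt_j) => /andP[].
have := sorted_f j; rewrite size_tuple eq_ij => /(_ lt_i).
by rewrite (nthE _ lt_i) (nthE _ lt_j) => /andP[].
Qed.

Lemma hom_path (G : graph) m :
  hom (path_graph m.+1) G = \sum_(u : vert G) walks (@adj G) m u.
Proof.
transitivity (\sum_(t : m.+1.-tuple (vert G)) (sorted (@adj G) t : nat)).
  rewrite /hom -sum1_card big_mkcond /=.
  rewrite (reindex (fun t : m.+1.-tuple (vert G) =>
    [ffun i => tnth t i] : {ffun vert (path_graph m.+1) -> vert G})) /=.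
    apply: eq_bigr => t _; rewrite inE is_hom_pathE.
    have -> : [tuple [ffun i => tnth t i] i | i < m.+1] = t.
      by apply: eq_from_tnth => i; rewrite tnth_mktuple ffunE.
    by case: sorted.
  exists (fun f : {ffun 'I_m.+1 -> vert G} => [tuple f i | i < m.+1]).
    by move=> t _; apply: eq_from_tnth => i; rewrite tnth_mktuple ffunE.
  by move=> f _; apply/ffunP => i; rewrite ffunE tnth_mktuple.
rewrite big_tuple_cons; apply: eq_bigr => u _; exact: sum_path_tuple.
Qed.

(** A walk of length i + j is cut at its vertex number i into two walks starting there, the first
    one read backwards. The induction moves the cut by one step. *)
Lemma walks_convolve (T : finType) (E : rel T) i j :
  symmetric E ->
  \sum_u walks E i u * walks E j u = \sum_u walks E (i + j) u.
Proof.
move=> symE; elim: i j => [|i IHi] j.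
  by apply: eq_bigr => u _; rewrite mul1n.
rewrite addSnnS -IHi.
under eq_bigr => u _ do rewrite walksS big_distrl /= big_mkcond.
rewrite exchange_big /=; apply: eq_bigr => v _.
rewrite -big_mkcond big_distrr /=.
by apply: eq_bigl => u; apply: symE.
Qed.

(** * Real sums and Gibbs' inequality *)

HB.instance Definition _ := Monoid.isComLaw.Build R 0%R Rplus
  (fun x y z => esym (Rplus_assoc x y z)) Rplus_comm Rplus_0_l.
HB.instance Definition _ := Monoid.isMulLaw.Build R 0%R Rmult
  Rmult_0_l Rmult_0_r.
HB.instance Definition _ := Monoid.isAddLaw.Build R Rmult Rplus
  Rmult_plus_distr_r Rmult_plus_distr_l.

Local Open Scope R_scope.

Local Notation "\rsum_ i F" := (\big[Rplus/0]_i F)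
  (at level 41, i at level 0, F at level 41, right associativity).

Lemma rsum_le (I : finType) (f g : I -> R) :
  (forall i, f i <= g i) -> \rsum_i f i <= \rsum_i g i.
Proof. by move=> le_fg; elim/big_ind2: _ => *; [lra | lra | apply: le_fg]. Qed.

Lemma rsum_ge_term (I : finType) (f : I -> R) i :
  (forall i, 0 <= f i) -> f i <= \rsum_i f i.
Proof.
move=> f_ge0; rewrite (bigD1 i) //=.
have : 0 <= \big[Rplus/0]_(j | j != i) f j.
  by elim/big_ind: _ => *; [lra | lra | apply: f_ge0].
lra.
Qed.

Lemma INR_sum (I : finType) (f : I -> nat) :
  INR (\sum_i f i) = \rsum_i INR (f i).
Proof. by elim/big_ind2: _ => // x1 y1 x2 y2 <- <-; rewrite plus_INR. Qed.

Lemma ln_le_sub1 x : 0 < x -> ln x <= x - 1.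
Proof.
move=> x_gt0; have := exp_ineq1_le (ln x); rewrite exp_ln //; lra.
Qed.

(** With S the sum of the [r i], apply ln x <= x - 1 to x = r i / (S * p i), multiply by [p i] and
    sum. Terms with [p i] = 0 vanish on the left. *)
Lemma gibbs (I : finType) (p r : I -> R) :
    (forall i, 0 <= p i) -> \rsum_i p i = 1 ->
    (forall i, 0 <= r i) -> (forall i, 0 < p i -> 0 < r i) ->
  \rsum_i (p i * (ln (r i) - ln (p i))) <= ln (\rsum_i r i).
Proof.
move=> p_ge0 sum_p r_ge0 r_gt0; set S := \rsum_i r i.
have S_gt0 : 0 < S.
  case: (Rlt_le_dec 0 S) => // S_le0; suff: \rsum_i p i = 0 by lra.
  rewrite big1 // => i _; case: (Rle_lt_or_eq_dec _ _ (p_ge0 i)) => // pi_gt0.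
  have := r_gt0 i pi_gt0; have := rsum_ge_term i r_ge0; rewrite -/S; lra.
have le_term i : p i * (ln (r i) - ln (p i)) <= r i * / S + (ln S - 1) * p i.
  case: (Rle_lt_or_eq_dec _ _ (p_ge0 i)) => [pi_gt0|<-]; last first.
    have := Rmult_le_pos _ _ (r_ge0 i) (Rlt_le _ _ (Rinv_0_lt_compat _ S_gt0)).
    lra.
  have ri_gt0 := r_gt0 i pi_gt0.
  have Sp_gt0 : 0 < S * p i by apply: Rmult_lt_0_compat.
  have := ln_le_sub1 (Rdiv_lt_0_compat _ _ ri_gt0 Sp_gt0).
  have iSp_gt0 := Rinv_0_lt_compat _ Sp_gt0.
  rewrite {1}/Rdiv ln_mult // ln_Rinv // ln_mult //.
  move=> /(Rmult_le_compat_l _ _ _ (p_ge0 i)).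
  have -> : p i * (r i / (S * p i) - 1) = r i * / S - p i by field; lra.
  lra.
apply: Rle_trans (rsum_le le_term) _.
rewrite big_split /= -big_distrl -big_distrr /= -/S sum_p.
have -> : S * / S = 1 by field; lra.
lra.
Qed.

(** * Means over a random walk as sums over edges *)

Definition rwalks (T : finType) (E : rel T) k u : R := INR (walks E k u).

(* The expectation of [f (x_i)] over a uniformly random walk
   [x_0 ... x_(i+j)]. *)
Definition mean (T : finType) (E : rel T) (i j : nat) (f : T -> R) : R :=
  (\rsum_u (rwalks E i u * rwalks E j u * f u))
    / INR (\sum_u walks E (i + j) u).

Definition edge_sum (T : finType) (E : rel T) (f : T -> T -> R) : R :=
  \rsum_u \rsum_v (if E u v then f u v else 0).

Lemma rwalks_ge0 (T : finType) (E : rel T) k u : 0 <= rwalks E k u.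
Proof. exact: pos_INR. Qed.

Lemma rwalksS (T : finType) (E : rel T) k u :
  rwalks E k.+1 u = \rsum_v (if E u v then rwalks E k v else 0).
Proof.
rewrite /rwalks walksS big_mkcond INR_sum.
by apply: eq_bigr => v _; case: (E u v).
Qed.

Lemma rwalksS_ge (T : finType) (E : rel T) k u v :
  E u v -> rwalks E k v <= rwalks E k.+1 u.
Proof.
move=> Euv; rewrite rwalksS.
have := @rsum_ge_term _ (fun v => if E u v then rwalks E k v else 0) v.
rewrite Euv; apply => w; case: (E u w); [exact: rwalks_ge0 | lra].
Qed.

Lemma edge_sum_fst (T : finType) (E : rel T) j (f : T -> R) :
  edge_sum E (fun u v => f u * rwalks E j v) =
  \rsum_u (f u * rwalks E j.+1 u).
Proof.
apply: eq_bigr => u _; rewrite rwalksS big_distrr /=.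
by apply: eq_bigr => v _; case: (E u v); lra.
Qed.

Lemma edge_sum_sym (T : finType) (E : rel T) (f : T -> T -> R) :
  symmetric E -> edge_sum E f = edge_sum E (fun u v => f v u).
Proof.
move=> symE; rewrite /edge_sum exchange_big.
by apply: eq_bigr => u _; apply: eq_bigr => v _; rewrite symE.
Qed.

Lemma edge_sum_ext (T : finType) (E : rel T) (f g : T -> T -> R) :
  (forall u v, E u v -> f u v = g u v) -> edge_sum E f = edge_sum E g.
Proof.
move=> eq_fg; apply: eq_bigr => u _; apply: eq_bigr => v _.
by case: (boolP (E u v)) => // /eq_fg.
Qed.

Lemma edge_sum_le (T : finType) (E : rel T) (f g : T -> T -> R) :
  (forall u v, E u v -> f u v <= g u v) -> edge_sum E f <= edge_sum E g.
Proof.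
move=> le_fg; apply: rsum_le => u; apply: rsum_le => v.
by case: (boolP (E u v)) => [/le_fg | _]; lra.
Qed.

Lemma edge_sumD (T : finType) (E : rel T) (f g : T -> T -> R) :
  edge_sum E (fun u v => f u v + g u v) = edge_sum E f + edge_sum E g.
Proof.
rewrite /edge_sum -big_split; apply: eq_bigr => u _.
by rewrite -big_split; apply: eq_bigr => v _ /=; case: (E u v); lra.
Qed.

Lemma edge_sumZ (T : finType) (E : rel T) c (f : T -> T -> R) :
  edge_sum E (fun u v => c * f u v) = c * edge_sum E f.
Proof.
rewrite /edge_sum big_distrr; apply: eq_bigr => u _ /=.
by rewrite big_distrr; apply: eq_bigr => v _ /=; case: (E u v); lra.
Qed.

Lemma rwalks_convolve (T : finType) (E : rel T) i j :
  symmetric E ->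
  \rsum_u (rwalks E i u * rwalks E j u) = INR (\sum_u walks E (i + j) u).
Proof.
move=> symE; rewrite -(walks_convolve i j symE) INR_sum.
by apply: eq_bigr => u _; rewrite -mult_INR.
Qed.

(** For symmetric [E], the weight [rwalks E i u * rwalks E j v] counts the walks whose step from x_i
    to x_(i+1) is (u, v); summing over v leaves the weight of x_i = u. *)
Lemma mean_fst (T : finType) (E : rel T) i j f :
  mean E i j.+1 f =
  edge_sum E (fun u v => rwalks E i u * rwalks E j v * f u)
    / INR (\sum_u walks E (i + j).+1 u).
Proof.
rewrite /mean addnS; congr (_ / _).
rewrite (@edge_sum_ext _ _ _
  (fun u v => rwalks E i u * f u * rwalks E j v)) => [|u v _]; last lra.
by rewrite edge_sum_fst; apply: eq_bigr => u _; lra.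
Qed.

Lemma mean_snd (T : finType) (E : rel T) i j f : symmetric E ->
  mean E i.+1 j f =
  edge_sum E (fun u v => rwalks E i u * rwalks E j v * f v)
    / INR (\sum_u walks E (i + j).+1 u).
Proof.
move=> symE; rewrite /mean addSn; congr (_ / _).
rewrite edge_sum_sym // (@edge_sum_ext _ _ _
  (fun u v => rwalks E j u * f u * rwalks E i v)) => [|u v _]; last lra.
by rewrite edge_sum_fst; apply: eq_bigr => u _; lra.
Qed.

(* The left-hand side is [E ln F(x_i) + E ln G(x_(i+1))] plus the entropy of the
   edge [(x_i, x_(i+1))], the probability of an edge [(u, v)] being
   [walks i u * walks j v / W]. *)
Lemma edge_gibbs (T : finType) (E : rel T) i j (F G : T -> R) :
    symmetric E -> (0 < \sum_u walks E (i + j).+1 u)%nat ->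
    (forall u, 0 <= F u) -> (forall u, 0 <= G u) ->
    (forall u v, E u v -> 0 < rwalks E i u -> 0 < rwalks E j v ->
       0 < F u /\ 0 < G v) ->
  mean E i j.+1 (fun u => ln (F u)) + mean E i.+1 j (fun v => ln (G v))
  + ln (INR (\sum_u walks E (i + j).+1 u))
  - mean E i j.+1 (fun u => ln (rwalks E i u))
  - mean E i.+1 j (fun v => ln (rwalks E j v))
  <= ln (edge_sum E (fun u v => F u * G v)).
Proof.
move=> symE /ltP/lt_0_INR W_gt0 F_ge0 G_ge0 FG_gt0.
rewrite !mean_fst !mean_snd //; set W := INR _ in W_gt0 *.
have sumW : edge_sum E (fun u v => rwalks E i u * rwalks E j v) = W.
  by rewrite edge_sum_fst rwalks_convolve // addnS.
pose p (x : T * T) :=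
  if E x.1 x.2 then rwalks E i x.1 * rwalks E j x.2 * / W else 0.
pose r (x : T * T) := if E x.1 x.2 then F x.1 * G x.2 else 0.
have iW_gt0 : 0 < / W by apply: Rinv_0_lt_compat.
have l_ge0 := @rwalks_ge0 T E.
have pair_sum f : \rsum_x (if E x.1 x.2 then f x.1 x.2 else 0) = edge_sum E f.
  by rewrite /edge_sum pair_big.
have := @gibbs _ p r; rewrite /r (pair_sum (fun u v => F u * G v)).
have p_ge0 x : 0 <= p x.
  rewrite /p; case: (E _ _); last lra.
  by do !apply: Rmult_le_pos => //; lra.
have sum_p : \rsum_x p x = 1.
  rewrite (pair_sum (fun u v => rwalks E i u * rwalks E j v * / W)).
  rewrite (@edge_sum_ext _ _ _
    (fun u v => / W * (rwalks E i u * rwalks E j v))) => [|u v _]; last lra.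
  by rewrite edge_sumZ sumW; field; lra.
have pos_of_p u v : 0 < rwalks E i u * rwalks E j v * / W ->
    0 < rwalks E i u /\ 0 < rwalks E j v.
  move=> p_gt0; have [lu lv] := (l_ge0 i u, l_ge0 j v).
  by split; [case: lu|case: lv] => // eq0; move: p_gt0; rewrite -eq0; lra.
have r_ge0 x : 0 <= r x.
  by rewrite /r; case: (E _ _); [apply: Rmult_le_pos | lra].
have r_gt0 x : 0 < p x -> 0 < r x.
  rewrite /p /r; case: (boolP (E x.1 x.2)) => [Euv q_gt0|_]; last lra.
  have [lu lv] := pos_of_p _ _ q_gt0.
  by have [Fu Gv] := FG_gt0 _ _ Euv lu lv; apply: Rmult_lt_0_compat.
move=> /(_ p_ge0 sum_p r_ge0 r_gt0); apply: Rle_trans.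
pose q u v := rwalks E i u * rwalks E j v.
have -> : \rsum_x (p x * (ln (if E x.1 x.2 then F x.1 * G x.2 else 0)
    - ln (p x))) =
  edge_sum E (fun u v => / W * (q u v * ln (F u) + (q u v * ln (G v)
    + (ln W * q u v + ((-1) * (q u v * ln (rwalks E i u))
    + (-1) * (q u v * ln (rwalks E j v))))))).
  rewrite -pair_sum; apply: eq_bigr => -[u v] _; rewrite /p /=.
  case Euv: (E u v); last lra.
  rewrite -/(q u v).
  have [q0|q_neq0] := Req_dec (q u v) 0; first by rewrite q0; lra.
  have q_gt0 : 0 < q u v * / W.
    apply: Rmult_lt_0_compat => //.
    by have := Rmult_le_pos _ _ (l_ge0 i u) (l_ge0 j v); rewrite -/(q u v); lra.
  have [lu lv] := pos_of_p _ _ q_gt0.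
  have [Fu Gv] := FG_gt0 _ _ Euv lu lv.
  rewrite ln_mult // ln_mult //; last by rewrite /q; apply: Rmult_lt_0_compat.
  rewrite ln_Rinv // {2}/q ln_mult //; lra.
rewrite edge_sumZ !edge_sumD !edge_sumZ sumW.
rewrite /q; apply: Req_le; field; lra.
Qed.

(** * Entropy inequalities for a uniformly random walk *)

Lemma ln_le x y : 0 < x -> x <= y -> ln x <= ln y.
Proof.
by move=> x_gt0 [lt_xy|->]; [apply/Rlt_le/ln_increasing | apply: Rle_refl].
Qed.

Lemma ln_le_INR x k : x <= INR k -> (0 < k)%nat -> ln x <= ln (INR k).
Proof.
move=> le_xk /ltP k_gt0.
case: (Rlt_le_dec 0 x) => [x_gt0|x_le0]; first exact: ln_le.
(* Outside the positive reals [ln] has the default value 0, and ln k >= 0 since k >= 1. *)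
have ln_x : ln x = 0.
  by rewrite /ln; case: Rlt_dec => // x_gt0; case: (Rlt_not_le _ _ x_gt0).
by rewrite ln_x -ln_1; apply: ln_le; [lra | apply: (le_INR 1)].
Qed.

Lemma mean_sym (T : finType) (E : rel T) i j f : mean E i j f = mean E j i f.
Proof.
rewrite /mean addnC; congr (_ / _).
by apply: eq_bigr => u _; rewrite (Rmult_comm (rwalks E i u)).
Qed.

Lemma mean_eq (T : finType) (E : rel T) i j f g :
    (forall u, 0 < rwalks E i u -> 0 < rwalks E j u -> f u = g u) ->
  mean E i j f = mean E i j g.
Proof.
move=> eq_fg; congr (_ / _); apply: eq_bigr => u _.
case: (rwalks_ge0 E i u) => [iu|<-]; last lra.
by case: (rwalks_ge0 E j u) => [ju|<-]; [rewrite eq_fg | lra].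
Qed.

Lemma meanD (T : finType) (E : rel T) i j f g :
  mean E i j (fun u => f u + g u) = mean E i j f + mean E i j g.
Proof.
rewrite /mean -Rdiv_plus_distr -big_split; congr (_ / _).
by apply: eq_bigr => u _ /=; lra.
Qed.

Lemma meanN (T : finType) (E : rel T) i j f :
  mean E i j (fun u => - f u) = - mean E i j f.
Proof.
rewrite /mean; transitivity (-1 * (\rsum_u (rwalks E i u * rwalks E j u * f u))
    / INR (\sum_u walks E (i + j) u)); last by rewrite /Rdiv; lra.
rewrite big_distrr; congr (_ / _).
by apply: eq_bigr => u _ /=; lra.
Qed.

Lemma mean0 (T : finType) (E : rel T) i j : mean E i j (fun=> 0) = 0.
Proof.
by rewrite /mean big1 => [|u _]; [rewrite /Rdiv Rmult_0_l | rewrite Rmult_0_r].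
Qed.

(* With [x_0 ... x_(i+j)] a uniformly random walk and [W] the number of walks,
   the entropy of [x_i] is [ln W - mean_ln i j - mean_ln j i] and that of the
   edge [(x_i, x_(i+1))] is [ln W - mean_ln (j+1) i - mean_ln (i+1) j], where
   the walk has length [i + j + 1]. *)
Definition mean_ln (T : finType) (E : rel T) i j : R :=
  mean E i j (fun u => ln (rwalks E j u)).

(** [rwalks E 1 u] is the degree of u, so this is the expected logarithm of the degree of x_i. *)
Definition mean_ln_deg (T : finType) (E : rel T) i j : R :=
  mean E i j (fun u => ln (rwalks E 1 u)).

Lemma mean_ln0 (T : finType) (E : rel T) i : mean_ln E i 0 = 0.
Proof.
by rewrite -[RHS](mean0 E i 0); apply: mean_eq => u _ _; rewrite /rwalks ln_1.
Qed.

Lemma mean_ln_deg_sym (T : finType) (E : rel T) i j :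
  mean_ln_deg E i j = mean_ln_deg E j i.
Proof. exact: mean_sym. Qed.

Lemma rwalks1_gt0 (T : finType) (E : rel T) u v : E u v -> 0 < rwalks E 1 u.
Proof. by move=> /(rwalksS_ge 0); rewrite /rwalks /=; lra. Qed.

(** Gibbs' inequality with both [F] and [G] the degree: deg u * deg v, summed over the edges (u, v),
    counts the walks of length 3 by their middle edge. *)
Lemma edge_entropy_deg (T : finType) (E : rel T) i j :
    symmetric E -> (0 < \sum_u walks E (i + j).+1 u)%nat ->
  mean_ln_deg E i j.+1 + mean_ln_deg E i.+1 j
  + ln (INR (\sum_u walks E (i + j).+1 u)) - mean_ln E j.+1 i - mean_ln E i.+1 j
  <= ln (INR (\sum_u walks E 3 u)).
Proof.
move=> symE W_gt0.
have := edge_gibbs symE W_gt0 (rwalks_ge0 E 1) (rwalks_ge0 E 1).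
rewrite edge_sum_fst rwalks_convolve // /mean_ln (mean_sym E j.+1 i); apply.
move=> u v Euv _ _; split; first exact: rwalks1_gt0 Euv.
by apply: (@rwalks1_gt0 _ _ v u); rewrite symE.
Qed.

(** The left-hand side is e_i - h_i, the entropy of x_(i+1) given x_i. The comparison is with a
    uniform neighbour of x_i: [F u] is the number of walks with x_i = u, divided by the degree of
    u. *)
Lemma cond_entropy_deg (T : finType) (E : rel T) i j :
    symmetric E -> (0 < \sum_u walks E (i + j).+1 u)%nat ->
  mean_ln E i j.+1 - mean_ln E i.+1 j <= mean_ln_deg E i j.+1.
Proof.
move=> symE W_gt0.
pose F u := rwalks E i u * rwalks E j.+1 u * / rwalks E 1 u.
have l_ge0 := rwalks_ge0 E.
have F_ge0 u : 0 <= F u.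
  apply: Rmult_le_pos; first exact: Rmult_le_pos.
  case: (l_ge0 1%nat u) => [u_gt0|<-]; last by rewrite Rinv_0; lra.
  by have := Rinv_0_lt_compat _ u_gt0; lra.
have := edge_gibbs symE W_gt0 F_ge0 (G := fun=> 1).
have F_gt0 u v : E u v -> 0 < rwalks E i u -> 0 < rwalks E j v -> 0 < F u.
  move=> Euv iu jv; have ju := rwalksS_ge j Euv.
  have /Rinv_0_lt_compat := rwalks1_gt0 Euv.
  by move=> ?; apply: Rmult_lt_0_compat => //; apply: Rmult_lt_0_compat; lra.
move=> /(_ (fun=> Rle_0_1)) gibbsF.
have {}gibbsF :=
  gibbsF (fun u v Euv iu jv => conj (F_gt0 u v Euv iu jv) Rlt_0_1).
have sumF :
    edge_sum E (fun u v => F u * 1) <= INR (\sum_u walks E (i + j).+1 u).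
  rewrite -addnS -rwalks_convolve // -[1]/(INR 1).
  rewrite (edge_sum_fst E 0 F); apply: rsum_le => u; rewrite /F.
  have := Rmult_le_pos _ _ (l_ge0 i u) (l_ge0 j.+1 u).
  case: (l_ge0 1%nat u) => [u_gt0 _|<-]; last lra.
  by apply: Req_le; field; lra.
have {sumF} := ln_le_INR sumF W_gt0.
have lnF : mean E i j.+1 (fun u => ln (F u)) =
    mean_ln E j.+1 i + mean_ln E i j.+1 - mean_ln_deg E i j.+1.
  rewrite /mean_ln (mean_sym E j.+1 i) -meanD /Rminus -meanN -meanD.
  apply: mean_eq => u iu ju; rewrite /F.
  have u_gt0 : 0 < rwalks E 1 u.
    case: (pickP (E u)) => [v Euv|E0]; first exact: rwalks1_gt0 Euv.
    by move: ju; rewrite rwalksS big1 => [|v _]; [lra | rewrite E0].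
  rewrite ln_mult ?ln_mult ?ln_Rinv //; last exact: Rinv_0_lt_compat.
  exact: Rmult_lt_0_compat.
have ln1 : mean E i.+1 j (fun=> ln 1) = 0 by rewrite ln_1 mean0.
move: gibbsF; rewrite lnF ln1 /mean_ln (mean_sym E j.+1 i); lra.
Qed.

(** This is e_i <= h_i + h_(i+1) after cancellation. [F] and [G] are the unnormalized laws of x_i
    and x_(i+1). *)
Lemma edge_entropy_le_add (T : finType) (E : rel T) i j :
    symmetric E -> (0 < \sum_u walks E (i + j).+1 u)%nat ->
  mean_ln E i j.+1 + mean_ln E j i.+1 <= ln (INR (\sum_u walks E (i + j).+1 u)).
Proof.
move=> symE W_gt0; set W := (\sum_u _)%nat in W_gt0 *.
pose F u := rwalks E i u * rwalks E j.+1 u.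
pose G u := rwalks E i.+1 u * rwalks E j u.
have l_ge0 := rwalks_ge0 E.
have F_ge0 u : 0 <= F u by apply: Rmult_le_pos.
have G_ge0 u : 0 <= G u by apply: Rmult_le_pos.
have := edge_gibbs symE W_gt0 F_ge0 G_ge0; rewrite -/W.
have FG_gt0 u v : E u v -> 0 < rwalks E i u -> 0 < rwalks E j v ->
    0 < F u /\ 0 < G v.
  move=> Euv iu jv; have ju := rwalksS_ge j Euv.
  have := rwalksS_ge i (_ : E v u); rewrite symE => /(_ Euv) iv.
  by split; apply: Rmult_lt_0_compat; lra.
move=> /(_ FG_gt0) gibbsFG.
have sumFG : edge_sum E (fun u v => F u * G v) <= INR (W * W).
  (* Extended from the edges to all pairs, the sum factors as W * W. *)
  apply: (@Rle_trans _ (\rsum_u \rsum_v (F u * G v))).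
    apply: rsum_le => u; apply: rsum_le => v.
    by have := Rmult_le_pos _ _ (F_ge0 u) (G_ge0 v); case: (E u v); lra.
  apply: Req_le; rewrite mult_INR.
  rewrite (eq_bigr (fun u => F u * INR W)) => [|u _].
    by rewrite -big_distrl /= rwalks_convolve // addnS.
  by rewrite -big_distrr /= rwalks_convolve // addSn.
have := ln_le_INR sumFG; rewrite muln_gt0 W_gt0 => /(_ isT).
have W_pos : 0 < INR W by apply: (lt_INR 0); apply/ltP.
rewrite mult_INR ln_mult //.
have mean_ln_mul i' j' :
    mean E i' j' (fun u => ln (rwalks E i' u * rwalks E j' u))
    = mean_ln E j' i' + mean_ln E i' j'.
  rewrite /mean_ln (mean_sym E j') -meanD; apply: mean_eq => u iu ju.
  by rewrite ln_mult.
move: gibbsFG; rewrite !mean_ln_mul /mean_ln (mean_sym E j.+1 i); lra.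
Qed.

(** This is h_i <= e_i. It holds edge by edge: walks of length j from v extend along (u, v) to walks
    of length j + 1 from u. *)
Lemma edge_entropy_ge (T : finType) (E : rel T) i j :
    symmetric E -> (0 < \sum_u walks E (i + j).+1 u)%nat ->
  mean_ln E i.+1 j <= mean_ln E i j.+1.
Proof.
move=> symE /ltP/lt_0_INR W_gt0; rewrite /mean_ln mean_fst mean_snd //.
apply: Rmult_le_compat_r; first by have := Rinv_0_lt_compat _ W_gt0; lra.
apply: edge_sum_le => u v Euv.
case: (rwalks_ge0 E j v) => [jv|<-]; last lra.
have ge0 := Rmult_le_pos _ _ (rwalks_ge0 E i u) (rwalks_ge0 E j v).
by apply: Rmult_le_compat_l => //; apply: ln_le => //; apply: rwalksS_ge.
Qed.

(** * The dual certificate and the resulting bound on walks *)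

(* [w - a i - b i] plays the role of [h_i], [w - a i - b i.+1] that of [e_i],
   [w] that of [ln W] and [M] that of [ln w_3].  The invariant [main] sums, for
   each [j < k], the entropies of the walks with index sequences (relative to
   [4j]) 0101 (once), 0121 (once), 0123
   ([4(n-j)-2] times), 2345 ([4j+2] times) and 4345 (once),
   together with the subadditivity of [e_(4j+1)], [e_(4j+2)], [e_(4j+3)] with
   weights [4j+1], [1] and [4(n-j)-3]. *)
Lemma entropy_certificate n (a b d : nat -> R) (w M : R) :
    a 0%nat = 0 -> b (4 * n + 1)%nat = 0 ->
    (forall i, (i < 4 * n + 1)%nat ->
     [/\ d i + d i.+1 + w - a i - b i.+1 <= M,
         b i - b i.+1 <= d i, a i.+1 - a i <= d i.+1,
         b i + a i.+1 <= w & b i.+1 <= b i /\ a i <= a i.+1]) ->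
  INR (4 * n + 1) * w <= INR (4 * n * n + 3 * n + 1) * M.
Proof.
move=> a0 bm H.
pose e i := w - a i - b i.+1; pose h i := w - a i - b i.
rewrite !(plus_INR, mult_INR) !INR_IZR_INZ /= -!INR_IZR_INZ.
set N := INR n.
have main k : (k <= n)%nat ->
    (4 * N + 1) * (w - b (4 * k)%nat) + (4 * INR k - 1) * e (4 * k)%nat
      - 4 * N * h (4 * k)%nat <= (4 * N + 3) * INR k * M.
  elim: k => [|k IHk] lt_kn.
    (* At k = 0 the invariant reduces to h_0 <= e_0. *)
    by have [_ _ _ _ [ge_b _]] := H 0%nat ltac:(lia);
    rewrite /e /h muln0 a0 /=; lra.
  have {IHk} := IHk (ltnW lt_kn).
  have -> : (4 * k.+1 = (4 * k).+4)%nat by lia.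
  have [A0 B0 C0 D0 [F0 G0]] := H (4 * k)%nat ltac:(lia).
  have [A1 B1 C1 D1 [F1 G1]] := H (4 * k).+1%nat ltac:(lia).
  have [A2 B2 C2 D2 [F2 G2]] := H (4 * k).+2%nat ltac:(lia).
  have [A3 B3 C3 D3 [F3 G3]] := H (4 * k).+3%nat ltac:(lia).
  have [A4 B4 C4 D4 [F4 G4]] := H (4 * k).+4%nat ltac:(lia).
  have le_kN : INR k + 1 <= N by rewrite -S_INR; apply: le_INR; apply/leP.
  have K_ge0 : 0 <= INR k by apply: pos_INR.
  rewrite S_INR /e /h; move: le_kN K_ge0; set K := INR k => le_kN K_ge0.
  (* [W0], [Wa], [Wb], [Wc], [Wd] belong to the walks 0101, 0121, 0123, 2345, 4345; the [d] terms at
     the ends of the middle edge are replaced by conditional entropies. *)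
  have W0 : b (4 * k)%nat - b (4 * k).+1 + (w - a (4 * k)%nat - b (4 * k).+1)
    + (a (4 * k).+1 - a (4 * k)%nat) <= M by lra.
  have Wa : a (4 * k).+1 - a (4 * k)%nat + (w - a (4 * k).+1 - b (4 * k).+2)
    + (a (4 * k).+2 - a (4 * k).+1) <= M by lra.
  have Wb : 0 <= M - (a (4 * k).+1 - a (4 * k)%nat
    + (w - a (4 * k).+1 - b (4 * k).+2) + (b (4 * k).+2 - b (4 * k).+3)) by lra.
  have Wc : 0 <= M - (a (4 * k).+3 - a (4 * k).+2
    + (w - a (4 * k).+3 - b (4 * k).+4)
    + (b (4 * k).+4 - b (4 * k).+4.+1)) by lra.
  have Wd : b (4 * k).+3 - b (4 * k).+4 + (w - a (4 * k).+3 - b (4 * k).+4)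
    + (b (4 * k).+4 - b (4 * k).+4.+1) <= M by lra.
  have S1 : 0 <= w - (b (4 * k).+1 + a (4 * k).+2) by lra.
  have S3 : 0 <= w - (b (4 * k).+3 + a (4 * k).+4) by lra.
  have {Wb} := Rmult_le_pos (4 * (N - K) - 2) _ ltac:(lra) Wb.
  have {Wc} := Rmult_le_pos (4 * K + 2) _ ltac:(lra) Wc.
  have {S1} := Rmult_le_pos (4 * K + 1) _ ltac:(lra) S1.
  have {S3} := Rmult_le_pos (4 * (N - K) - 3) _ ltac:(lra) S3.
  move: W0 Wa Wd D2; clear; lra.
(* The remaining [M] comes from a walk 0101 on the last edge, together with h_m <= e_(m-1) for m =
   4n + 1. *)
have {main} := main n (leqnn n); rewrite -/N /e /h.
have [A0 B0 C0 D0 [F0 G0]] := H (4 * n)%nat ltac:(lia).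
move: bm; rewrite addn1 => bm; rewrite bm in A0 B0 D0 F0 *.
lra.
Qed.

Lemma ln_walks_le n (T : finType) (E : rel T) :
    symmetric E -> (0 < \sum_u walks E (4 * n + 1) u)%nat ->
  INR (4 * n + 1) * ln (INR (\sum_u walks E (4 * n + 1) u))
    <= INR (4 * n * n + 3 * n + 1) * ln (INR (\sum_u walks E 3 u)).
Proof.
move=> symE W_gt0; set m := (4 * n + 1)%nat in W_gt0 *.
apply: (@entropy_certificate n (fun i => mean_ln E (m - i) i)
  (fun i => mean_ln E i (m - i)) (fun i => mean_ln_deg E i (m - i))).
- exact: mean_ln0.
- by rewrite subnn mean_ln0.
move=> i lt_im; rewrite -/m in lt_im.
have [j def_m] : exists j, m = (i + j).+1 by exists (m - i.+1)%nat; lia.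
have -> : (m - i = j.+1)%nat by lia.
have -> : (m - i.+1 = j)%nat by lia.
have W_gt0' : (0 < \sum_u walks E (j + i).+1 u)%nat by rewrite addnC -def_m.
rewrite def_m in W_gt0 *; split.
- exact: edge_entropy_deg.
- exact: cond_entropy_deg.
- by rewrite mean_ln_deg_sym; apply: cond_entropy_deg.
- exact: edge_entropy_le_add.
- by split; apply: edge_entropy_ge.
Qed.

Lemma walks_prefix_gt0 (T : finType) (E : rel T) k j u :
  (0 < walks E (k + j) u)%nat -> (0 < walks E k u)%nat.
Proof.
elim: k u => [//|k IHk] u; rewrite addSn !walksS !lt0n !sum_nat_eq0.
apply: contraNN => /forall_inP walks0; apply/forall_inP => v Euv.
move: (walks0 v Euv) (IHk v); rewrite !eqn0Ngt => /negPf ->.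
by case: (ltnP 0 (walks E (k + j) v)) => // _ /(_ isT).
Qed.

Lemma exp_le x y : x <= y -> exp x <= exp y.
Proof.
by case=> [lt_xy|->]; [apply/Rlt_le/exp_increasing | apply: Rle_refl].
Qed.

Lemma HDE_set_exponent n : (1 <= n)%nat ->
  HDE_set (path_graph 4) (path_graph (4 * n + 2))
    (INR (4 * n + 1) / INR (4 * n * n + 3 * n + 1)).
Proof.
move=> n_gt0 T; have -> : (4 * n + 2 = (4 * n + 1).+1)%nat by lia.
rewrite !hom_path /rpow.
case: Rlt_dec => /= [W_gt0|_]; last exact: pos_INR.
have {}W_gt0 : (0 < \sum_u walks (@adj T) (4 * n + 1) u)%nat.
  by apply/ltP/INR_lt.
have W3_gt0 : (0 < \sum_u walks (@adj T) 3 u)%nat.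
  rewrite lt0n sum_nat_eq0; apply: contraL W_gt0 => /forallP walks0.
  rewrite -eqn0Ngt sum_nat_eq0; apply/forallP => u; move: (walks0 u) => /=.
  (* As n >= 1, a walk of length 4n + 1 begins with one of length 3. *)
  have -> : (4 * n + 1 = 3 + (4 * n - 2))%nat by lia.
  by rewrite !eqn0Ngt; apply/contraNN/walks_prefix_gt0.
have B_gt0 : 0 < INR (4 * n * n + 3 * n + 1) by apply/(lt_INR 0)/ltP; lia.
have := ln_walks_le (@adj_sym T) W_gt0; set W := \sum_u walks _ (4 * n + 1) u.
move: W3_gt0 => /ltP/lt_0_INR W3_gt0 le_ln.
rewrite -[X in _ <= X]exp_ln // /Rpower; apply: exp_le.
apply: (Rmult_le_reg_l _ _ _ B_gt0); apply: Rle_trans le_ln.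
by apply: Req_le; field; lra.
Qed.

(* Walks in the layered graphs *)
Local Close Scope R_scope.

(* The layered graph extremal for the inequality.  Layer [i] consists of the
   [(i, x, t)] with [x < q ^ layer_exp n i] and [t < q]; consecutive layers are
   completely joined, except that from layer [i] to layer [i + 1] with [4 %| i]
   the coordinate [t] is kept.
   Layer [i] has [q ^ h_i] vertices and is joined to layer [i + 1] by [q ^ e_i]
   edges, for an optimal solution [(h, e)] of the linear program. *)
Definition layer_exp (n i : nat) : nat :=
  match i %% 4 with
  | 0 => 2 * (n - i %/ 4) | 2 => 2 * (n - 1 - i %/ 4) | _ => 2 * (i %/ 4)
  end.

(** A vertex of layer i has at most [q ^ degree_exp n i] neighbours in each of the two adjacent
    layers. *)
Definition degree_exp (n i : nat) : nat :=
  match i %% 4 with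
  | 0 => 2 * (i %/ 4) | 1 => 2 * (n - i %/ 4)
  | 2 => (2 * (i %/ 4)).+1 | _ => (2 * (n - i %/ 4)).-1
  end.

Definition layered_vertex (n q : nat) : finType :=
  ('I_(4 * n + 2) * 'I_(q ^ (2 * n)) * 'I_q)%type.

Definition in_layer n q i (u : layered_vertex n q) : bool :=
  (u.1.1 == i :> nat) && (u.1.2 < q ^ layer_exp n i).

Definition joined n q : rel (layered_vertex n q) := fun u v =>
  [&& in_layer u.1.1 u, in_layer u.1.1.+1 v & (4 %| u.1.1) ==> (u.2 == v.2)].

Definition layered_graph (n q : nat) : graph :=
  @Graph (layered_vertex n q) (fun u v => joined u v || joined v u).

Lemma layered_adjE n q (u v : layered_vertex n q) :
  @adj (layered_graph n q) u v = joined u v || joined v u.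
Proof. by rewrite /adj /= [joined v u || _]orbC andbb. Qed.

Lemma layer_exp_le n i : i < 4 * n + 2 -> layer_exp n i <= 2 * n.
Proof.
rewrite /layer_exp => lt_i; have := divn_eq i 4; have : i %% 4 < 4 by lia.
by case: (i %% 4) => [|[|[|[|]]]] //; lia.
Qed.

Lemma card_lt_ord m a : a <= m -> #|[set x : 'I_m | x < a]| = a.
Proof.
move=> le_am; rewrite cardsE -sum1_card -(big_ord_widen _ (fun=> 1)) //.
by rewrite sum1_card card_ord.
Qed.

Lemma card_layer_slice n q i (fixed : bool) (t : 'I_q) :
    i < 4 * n + 2 -> 0 < q ->
  #|[pred u : layered_vertex n q | in_layer i u & fixed ==> (t == u.2)]|
    = q ^ (layer_exp n i + ~~ fixed).
Proof.
move=> lt_i q_gt0.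
have le_exp : q ^ layer_exp n i <= q ^ (2 * n).
  by apply: leq_pexp2l => //; apply: layer_exp_le.
pose A := setX (setX [set Ordinal lt_i]
    [set x : 'I_(q ^ (2 * n)) | x < q ^ layer_exp n i])
  [set s : 'I_q | fixed ==> (t == s)].
rewrite (@eq_card _ _ (mem A)) => [|[[j x] s]]; last by rewrite !inE.
rewrite !cardsX cards1 mul1n card_lt_ord // expnD; congr (_ * _).
case: fixed {A} => /=; last by rewrite cardsT card_ord.
by rewrite expn0 -(cards1 t); apply: eq_card => s; rewrite !inE eq_sym.
Qed.

Lemma card_layer n q i : i < 4 * n + 2 -> 0 < q ->
  #|[pred u : layered_vertex n q | in_layer i u]| = q ^ (layer_exp n i).+1.
Proof.
move=> lt_i q_gt0.
rewrite -addn1 -(@card_layer_slice n q i false (Ordinal q_gt0)) //.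
by apply: eq_card => u; rewrite !inE andbT.
Qed.

Lemma card_joined_above n q (u : layered_vertex n q) i :
    in_layer i u -> i.+1 < 4 * n + 2 -> 0 < q ->
  #|joined u| = q ^ (layer_exp n i.+1 + ~~ (4 %| i)).
Proof.
move=> u_i lt_i q_gt0; rewrite -(@card_layer_slice n q _ _ u.2) //.
apply: eq_card => v; rewrite !inE /joined.
by have /andP[/eqP -> _] := u_i; rewrite u_i.
Qed.

Lemma card_joined_below n q (v : layered_vertex n q) i :
    in_layer i.+1 v -> 0 < q ->
  #|[pred u | joined u v]| = q ^ (layer_exp n i + ~~ (4 %| i)).
Proof.
move=> v_i q_gt0; have /andP[/eqP def_i _] := v_i.
have lt_i : i < 4 * n + 2 by rewrite ltnW // -def_i.
rewrite -(@card_layer_slice n q _ _ v.2) //.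
apply: eq_card => u; rewrite !inE /joined.
case: (eqVneq (u.1.1 : nat) i) => [->|neq_i]; first by rewrite v_i eq_sym.
rewrite {2}/in_layer def_i eqSS eq_sym (negPf neq_i) andbF.
by rewrite /in_layer (negPf neq_i).
Qed.

(** The last bound controls the walks of length 3 with middle edge between layers i and i + 1: it
    adds the exponents of the layer size, of the upward degree and of the degree bounds at both
    ends. *)
Lemma layer_degree_exp n i : i.+1 < 4 * n + 2 ->
  [/\ layer_exp n i.+1 + ~~ (4 %| i) <= degree_exp n i,
      layer_exp n i + ~~ (4 %| i) <= degree_exp n i.+1 &
      (layer_exp n i).+1 + (layer_exp n i.+1 + ~~ (4 %| i)
        + (degree_exp n i + degree_exp n i.+1)) <= 4 * n + 1].
Proof.
move=> lt_i; rewrite /layer_exp /degree_exp /dvdn.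
have def_i := divn_eq i 4; have lt_i4 : i %% 4 < 4 by lia.
move: def_i lt_i4; set k := i %/ 4; case: (i %% 4) => [|[|[|[|]]]] // def_i _.
- have -> : i.+1 %% 4 = 1 by lia.
  have -> : i.+1 %/ 4 = k by lia.
  by split; lia.
- have -> : i.+1 %% 4 = 2 by lia.
  have -> : i.+1 %/ 4 = k by lia.
  by split; lia.
- have -> : i.+1 %% 4 = 3 by lia.
  have -> : i.+1 %/ 4 = k by lia.
  by split; lia.
have -> : i.+1 %% 4 = 0 by lia.
have -> : i.+1 %/ 4 = k.+1 by lia.
by split; lia.
Qed.

Lemma in_layer_lt n q i (u : layered_vertex n q) :
  in_layer i u -> i < 4 * n + 2.
Proof. by move=> /andP[/eqP <- _]. Qed.

Lemma joined_in_layer n q i (u v : layered_vertex n q) :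
  in_layer i u -> joined u v -> in_layer i.+1 v.
Proof. by move=> /andP[/eqP <- _] /and3P[]. Qed.

Lemma card_joined_above_le n q (u : layered_vertex n q) i :
    in_layer i u -> 0 < q -> #|joined u| <= q ^ degree_exp n i.
Proof.
move=> u_i q_gt0; have [lt_i|ge_i] := ltnP i.+1 (4 * n + 2).
  rewrite (card_joined_above u_i) //; apply: leq_pexp2l => //.
  by have [] := layer_degree_exp lt_i.
rewrite eq_card0 // => v; apply/negbTE/negP => /(joined_in_layer u_i).
by move=> /in_layer_lt; rewrite ltnNge ge_i.
Qed.

Lemma card_joined_below_le n q (u : layered_vertex n q) i :
    in_layer i u -> 0 < q -> #|[pred v | joined v u]| <= q ^ degree_exp n i.
Proof.
case: i => [|i] u_i q_gt0.
  rewrite eq_card0 // => v; rewrite inE; apply/negbTE/negP => /and3P[_ + _].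
  by move: u_i => /andP[/eqP u_i _] /andP[/eqP]; rewrite u_i.
rewrite (card_joined_below u_i) //; apply: leq_pexp2l => //.
by have [] := layer_degree_exp (in_layer_lt u_i).
Qed.

Local Notation layered_adj n q := (@adj (layered_graph n q)).

Lemma layered_degree_le n q (u : layered_vertex n q) i :
    in_layer i u -> 0 < q ->
  walks (layered_adj n q) 1 u <= 2 * q ^ degree_exp n i.
Proof.
move=> u_i q_gt0; rewrite walksS sum1_card.
rewrite (@eq_card _ _ [predU joined u & [pred v | joined v u]]) => [|v];
  last by rewrite !inE -layered_adjE.
apply: leq_trans (leq_addr #|[predI joined u & [pred v | joined v u]]| _) _.
rewrite cardUI mul2n -addnn.
by apply: leq_add; [apply: card_joined_above_le | apply: card_joined_below_le].
Qed.

(** The factor in front is the size of layer i, so that summing over the layer gives the bound on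
    the right. *)
Lemma sum_joined_degree_le n q (u : layered_vertex n q) i : 0 < q ->
    in_layer i u ->
  q ^ (layer_exp n i).+1 * (\sum_(v | joined u v)
    walks (layered_adj n q) 1 u * walks (layered_adj n q) 1 v)
    <= 4 * q ^ (4 * n + 1).
Proof.
move=> q_gt0 u_i; have [lt_i|ge_i] := ltnP i.+1 (4 * n + 2); last first.
  rewrite big1 ?muln0 // => v /(joined_in_layer u_i)/in_layer_lt.
  by rewrite ltnNge ge_i.
set c := 4 * q ^ (degree_exp n i + degree_exp n i.+1).
have le_term v : joined u v ->
    walks (layered_adj n q) 1 u * walks (layered_adj n q) 1 v <= c.
  move=> /(joined_in_layer u_i) v_i.
  rewrite /c expnD -[4]/(2 * 2) mulnACA.
  by apply: leq_mul; apply: layered_degree_le.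
apply: leq_trans (leq_mul (leqnn _) (leq_sum _ le_term)) _.
rewrite sum_nat_const (card_joined_above u_i) // /c.
rewrite mulnCA [_ ^ _ * (4 * _)]mulnCA mulnCA -!expnD leq_mul2l /=.
apply: leq_pexp2l => //; rewrite addnCA.
by have [] := layer_degree_exp lt_i.
Qed.

(** Walks are counted by their middle edge. In the constant, 2 is for the directions of an edge, 4
    for the two degree bounds and 4n + 2 for the layers. *)
Lemma layered_walks3_le n q : 0 < q ->
  \sum_u walks (layered_adj n q) 3 u <= 8 * (4 * n + 2) * q ^ (4 * n + 1).
Proof.
move=> q_gt0; set E := layered_adj n q.
have symE : symmetric E by apply: adj_sym.
pose f u v := walks E 1 u * walks E 1 v.
have -> : \sum_u walks E 3 u = \sum_u \sum_(v | E u v) f u v.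
  rewrite -(walks_convolve 1 2 symE); apply: eq_bigr => u _.
  by rewrite [walks E 2 u]walksS big_distrr.
have le_f : \sum_u \sum_(v | E u v) f u v
    <= 2 * \sum_u \sum_(v | joined u v) f u v.
  rewrite mul2n -addnn.
  have {2}-> : \sum_u \sum_(v | joined u v) f u v =
      \sum_u \sum_(v | joined v u) f u v.
    rewrite (exchange_big_dep xpredT) //=.
    by do 2![apply: eq_bigr => ? _]; rewrite /f mulnC.
  rewrite -big_split; apply: leq_sum => u _ /=.
  rewrite [\sum_(v | E u v) _]big_mkcond !(big_mkcond (joined _)).
  rewrite (big_mkcond (fun v => joined v u)) -big_split.
  apply: leq_sum => v _ /=.
  rewrite /E layered_adjE; case: (joined u v); case: (joined v u) => //=; lia.
apply: leq_trans le_f _.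
rewrite -[8]/(2 * 4) -!mulnA leq_mul2l /= mulnCA.
have layer_le (i : 'I_(4 * n + 2)) :
    \sum_(u : layered_vertex n q | u.1.1 == i) \sum_(v | joined u v) f u v
    <= 4 * q ^ (4 * n + 1).
  set S := fun u => \sum_(v | joined u v) f u v.
  (* The bound for the layer is spread evenly over its vertices, rounded down. *)
  pose b := (4 * q ^ (4 * n + 1)) %/ q ^ (layer_exp n i).+1.
  have exp_gt0 : 0 < q ^ (layer_exp n i).+1 by rewrite expn_gt0 q_gt0.
  apply: (@leq_trans (\sum_(u : layered_vertex n q | in_layer i u) b));
    last first.
    by rewrite sum_nat_const card_layer // mulnC /b leq_trunc_div.
  rewrite big_mkcond [leqRHS]big_mkcond; apply: leq_sum => u _.
  case: (eqVneq u.1.1 i) => [def_i|//].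
  case: (boolP (in_layer i u)) => [u_i|not_i].
    by rewrite leq_divRL // mulnC sum_joined_degree_le.
  rewrite leqn0 /S big1 // => v /and3P[]; rewrite def_i => u_i.
  by rewrite u_i in not_i.
rewrite (partition_big (fun u : layered_vertex n q => u.1.1) xpredT) //=.
apply: leq_trans (leq_sum _ (fun i _ => layer_le i)) _.
by rewrite sum_nat_const card_ord.
Qed.

Lemma layered_walksS_ge n q k i c : 0 < q ->
    (forall v, in_layer i v -> c <= walks (layered_adj n q) k v) ->
  forall u, in_layer i.+1 u ->
  c * q ^ (layer_exp n i + ~~ (4 %| i)) <= walks (layered_adj n q) k.+1 u.
Proof.
move=> q_gt0 ge_c u u_i; rewrite -(card_joined_below u_i) // mulnC.
rewrite -sum_nat_const walksS big_mkcond [leqRHS]big_mkcond.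
apply: leq_sum => v _; rewrite layered_adjE inE.
case Jvu: (joined v u) => //=; rewrite orbT; apply: ge_c.
move: u_i Jvu => /andP[/eqP u_i _] /and3P[v_i /andP[/eqP]].
by rewrite u_i => -[->].
Qed.

(** Only walks descending to layer 0 are counted; each descent by four layers contributes a factor
    q^(4n+1). *)
Lemma layered_walks_ge n q k : 0 < q -> k <= n ->
  forall u, in_layer (4 * k) u ->
  q ^ (k * (4 * n + 1)) <= walks (layered_adj n q) (4 * k) u.
Proof.
move=> q_gt0; elim: k => [|k IHk] lt_kn; first by rewrite muln0.
have -> : 4 * k.+1 = (4 * k).+4 by lia.
have step i c := @layered_walksS_ge n q i i c q_gt0.
have := step _ _ (step _ _ (step _ _ (step _ _ (IHk (ltnW lt_kn))))).
rewrite -!expnD => ge_walks u /ge_walks; apply: leq_trans.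
apply: leq_pexp2l => //; rewrite /layer_exp /dvdn.
have -> : 4 * k %% 4 = 0 by lia.
have -> : (4 * k).+1 %% 4 = 1 by lia.
have -> : (4 * k).+2 %% 4 = 2 by lia.
have -> : (4 * k).+3 %% 4 = 3 by lia.
lia.
Qed.

(** The top layer has q^(2n+1) vertices, each with a single neighbour in layer 4n, and n(4n+1) + 2n
    + 1 = 4n^2 + 3n + 1. *)
Lemma layered_walks_total_ge n q : 0 < q ->
  q ^ (4 * n * n + 3 * n + 1) <= \sum_u walks (layered_adj n q) (4 * n + 1) u.
Proof.
move=> q_gt0; rewrite [4 * n + 1]addn1.
have ge_walks := layered_walksS_ge q_gt0 (layered_walks_ge q_gt0 (leqnn n)).
apply: leq_trans (_ : \sum_(u : layered_vertex n q | in_layer (4 * n).+1 u)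
  q ^ (n * (4 * n + 1)) * q ^ (layer_exp n (4 * n) + ~~ (4 %| 4 * n)) <= _).
  rewrite sum_nat_const card_layer ?addn2 // -!expnD; apply: leq_pexp2l => //.
  rewrite /layer_exp /dvdn.
  have -> : 4 * n %% 4 = 0 by lia.
  have -> : (4 * n).+1 %% 4 = 1 by lia.
  lia.
rewrite big_mkcond; apply: leq_sum => u _.
by case: ifP => // u_i; apply: ge_walks.
Qed.

(** * Optimality of the exponent *)

Local Open Scope R_scope.

Lemma INR_expn q k : INR (q ^ k)%nat = INR q ^ k.
Proof. by elim: k => //= k IHk; rewrite expnS mult_INR IHk. Qed.

Lemma ln_INR_expn q k :
  (0 < q)%nat -> ln (INR (q ^ k)%nat) = INR k * ln (INR q).
Proof. by move=> /ltP/lt_0_INR q_gt0; rewrite INR_expn ln_pow. Qed.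

Lemma exponent_le_of_HDE_set n c :
    HDE_set (path_graph 4) (path_graph (4 * n + 2)) c -> 0 < c ->
  c * INR (4 * n * n + 3 * n + 1) <= INR (4 * n + 1).
Proof.
move=> c_HDE c_gt0; set B := (_ + _ + 1)%nat; set A := (4 * n + 1)%nat.
set C := INR (8 * (4 * n + 2)).
have C_gt0 : 0 < C by apply/(lt_INR 0)/ltP; lia.
have le_ln q : (0 < q)%nat ->
    c * (INR B * ln (INR q)) <= ln C + INR A * ln (INR q).
  move=> q_gt0; have := c_HDE (layered_graph n q).
  have -> : (4 * n + 2 = A.+1)%nat by rewrite /A; lia.
  rewrite !hom_path /rpow.
  have := layered_walks_total_ge n q_gt0; rewrite -/A -/B.
  set W := (\sum_u walks _ A u)%nat => le_W.
  have := layered_walks3_le n q_gt0; rewrite -/A.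
  set W3 := (\sum_u walks _ 3 u)%nat => le_W3.
  have qX_gt0 k : (0 < q ^ k)%nat by rewrite expn_gt0 q_gt0.
  have qX_gt0R k : 0 < INR (q ^ k)%nat by apply/(lt_INR 0)/ltP.
  have {le_W} le_W : INR (q ^ B) <= INR W by apply/le_INR/leP.
  case: Rlt_dec => /= [W_gt0 le_pow|]; last by have := qX_gt0R B; lra.
  have {le_W3} le_W3 : INR W3 <= C * INR (q ^ A).
    by rewrite -mult_INR; apply/le_INR/leP.
  rewrite -!ln_INR_expn // -ln_mult //.
  apply: (@Rle_trans _ (c * ln (INR W))).
    by apply: Rmult_le_compat_l; [lra | apply: ln_le].
  rewrite -[c * _]ln_exp; apply: ln_le; first exact: exp_pos.
  exact: Rle_trans le_pow le_W3.
apply: Rnot_lt_le => lt_AB.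
have eps_gt0 : 0 < c * INR B - INR A by lra.
(* If c B > A, this q has (c B - A) ln q > ln C, against [le_ln]. *)
have [q lt_q] := INR_unbounded (exp (ln C / (c * INR B - INR A))).
have q_gt0 : 0 < INR q by have := exp_pos (ln C / (c * INR B - INR A)); lra.
have /le_ln : (0 < q)%nat by apply/ltP/INR_lt.
have := ln_increasing _ _ (exp_pos _) lt_q; rewrite ln_exp.
move=> /(Rmult_lt_compat_r _ _ _ eps_gt0).
have -> : ln C / (c * INR B - INR A) * (c * INR B - INR A) = ln C by field; lra.
lra.
Qed.

Theorem theorem3p4 (n : nat) (hn : (1 <= n)%coq_nat) :
  HDE_eq (path_graph 4) (path_graph (4 * n + 2))
    (INR (4 * n + 1) / INR (4 * n * n + 3 * n + 1))%R.
Proof.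
have B_gt0 : (0 < INR (4 * n * n + 3 * n + 1))%R by apply/(lt_INR 0)/ltP; lia.
split=> [c c_HDE|b]; last by apply; move: hn => /leP/HDE_set_exponent.
case: (Rle_lt_dec c 0) => [c_le0|c_gt0].
  apply: Rle_trans c_le0 _; apply: Rmult_le_pos; first exact: pos_INR.
  by apply/Rlt_le/Rinv_0_lt_compat.
apply: (Rmult_le_reg_r _ _ _ B_gt0).
have -> : (INR (4 * n + 1) / INR (4 * n * n + 3 * n + 1)
    * INR (4 * n * n + 3 * n + 1) = INR (4 * n + 1))%R by field; lra.
exact: exponent_le_of_HDE_set.
Qed.
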